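(* Let $\mathfrak R=\mathbb Z[x^{\pm1},y^{\pm1}]$ and $(\mathfrak b,\mathfrak c,\mathfrak d)=(y^p,y^q,y^r)$ with $p,q,r\in\mathbb Z$ such that $2r\ne p+q$. For $n\ge 3$, let $B$ be the Artin-Tits group of type $B_n$, let $\Gamma_1=A_{2n-1}$ and $\Gamma_3=D_{n+1}$, and for $k\in\{1,3\}$ let $\psi_k:B_{\Gamma_k}\to\mathrm{GL}(V_k)$ be an LK-representation of the Artin-Tits group $B_{\Gamma_k}$ over $\mathfrak R$ with parameters $(\mathfrak b,\mathfrak c,\mathfrak d)$, and $\psi_k^{G_k}:B\to\mathrm{GL}(V_k^{G_k})$ the associated twisted LK-representation of $B$. Then $\psi_1^{G_1}$ and $\psi_3^{G_3}$ are non-equivalent, except possibly for two values of $n$ when $r<0<p+q$ or $p+q<0<r$. That is: if neither $r<0<p+q$ nor $p+q<0<r$ holds, they are non-equivalent for every $n\ge3$; and if one of these holds, they are non-equivalent for every $n\geq 3$ outside a set of at most two values (depending only on $p,q,r$).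
   Context: For a Coxeter matrix of small type $\Gamma=(m_{i,j})_{i,j\in I}$ ($I$ finite, $m_{i,j}=m_{j,i}\in\{1,2,3\}$, $m_{i,j}=1\Leftrightarrow i=j$), the Artin-Tits group $B_\Gamma$ is generated by $\mathbf s_i$ ($i\in I$) with relations $\mathbf s_i\mathbf s_j=\mathbf s_j\mathbf s_i$ if $m_{i,j}=2$, $\mathbf s_i\mathbf s_j\mathbf s_i=\mathbf s_j\mathbf s_i\mathbf s_j$ if $m_{i,j}=3$. Let $E=\bigoplus_{i\in I}\mathbb R\alpha_i$ with symmetric bilinear form $(\alpha_i|\alpha_j)=-2\cos(\pi/m_{i,j})$; the Coxeter group $W$ with generators $s_i$ acts by $s_i(\beta)=\beta-(\beta|\alpha_i)\alpha_i$. $\Phi=\{w(\alpha_i)\mid w\in W, i\in I\}$, $\Phi^+$ = elements of $\Phi$ with non-negative coordinates, $\Phi^-=-\Phi^+$, and $\mathrm{dp}(\alpha)=\min\{l(w)\mid w(\alpha)\in\Phi^-\}$ for $\alpha\in\Phi^+$ ($l$ = word length in the $s_i$). $V$ is the free $\mathfrak R$-module with basis $(e_\alpha)_{\alpha\in\Phi^+}$. Set $\mathfrak a=\mathfrak d-\mathfrak b\mathfrak c/\mathfrak d$. $\varphi_i\in\mathscr L(V)$ is given by: $\varphi_i(e_{\alpha_i})=0$; $\varphi_i(e_\alpha)=\mathfrak d e_\alpha$ if $s_i(\alpha)=\alpha$; and if $\alpha,\beta\in\Phi^+$, $\beta=s_i(\alpha)$, $\mathrm{dp}(\beta)>\mathrm{dp}(\alpha)$,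 then $\varphi_i(e_\beta)=\mathfrak b e_\alpha$, $\varphi_i(e_\alpha)=\mathfrak a e_\alpha+\mathfrak c e_\beta$. An LK-family is $(f_i)_{i\in I}\in(V^\star)^I$ such that $f_i(e_{\alpha_j})=0$ for $i\ne j$; $f_i\varphi_j=\mathfrak d f_i$ if $m_{i,j}=2$; $f_i\varphi_j=f_j\varphi_i$ if $m_{i,j}=3$. An LK-representation of $B_\Gamma$ is the homomorphism $\psi:B_\Gamma\to\mathrm{GL}(V)$ given by $\mathbf s_i\mapsto(v\mapsto\varphi_i(v)+f_i(v)e_{\alpha_i})$ for an LK-family $(f_i)$ with $f_i(e_{\alpha_i})\in\mathfrak R^\times$ for all $i\in I$. The Artin-Tits group $B$ of type $B_n$ has generators $\Delta_1,\dots,\Delta_n$ with relations $\Delta_i\Delta_j=\Delta_j\Delta_i$ if $|i-j|\ge2$, $\Delta_i\Delta_{i+1}\Delta_i=\Delta_{i+1}\Delta_i\Delta_{i+1}$ for $1\le i\le n-2$, and $\Delta_{n-1}\Delta_n\Delta_{n-1}\Delta_n=\Delta_n\Delta_{n-1}\Delta_n\Delta_{n-1}$. Vertices of $\Gamma_1=A_{2n-1}$ are labelled $1,\dots,2n-1$ along the chain; those of $\Gamma_3=D_{n+1}$ are labelled so that $1,\dots,n-1$ form a chain and $n-1$ is joined to both $n$ and $n+1$. $G_1$ is generated by the graph automorphism $i\mapsto 2n-i$ of $\Gamma_1$; $G_3$ is generated by the graph automorphism of $\Gamma_3$ exchanging $n$ and $n+1$ and fixing the other vertices. $G_k$ acts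 on $B_{\Gamma_k}$ by $\mathbf s_i\mapsto\mathbf s_{g(i)}$, on positive roots via $\alpha_i\mapsto\alpha_{g(i)}$, and on $V_k$ by $e_\alpha\mapsto e_{g(\alpha)}$; $V_k^{G_k}$ is the fixed submodule. $B$ is identified with the subgroup $(B_{\Gamma_k})^{G_k}$ of fixed elements as follows: for $k=1$, $\Delta_i=\mathbf s_i\mathbf s_{2n-i}$ ($1\le i<n$), $\Delta_n=\mathbf s_n$; for $k=3$, $\Delta_i=\mathbf s_i$ ($1\le i<n$), $\Delta_n=\mathbf s_n\mathbf s_{n+1}$. The elements $\psi_k(b)$, $b\in B$, stabilize $V_k^{G_k}$, and $\psi_k^{G_k}(b)=\psi_k(b)|_{V_k^{G_k}}$. Two linear representations $\rho,\rho'$ of $B$ on $\mathfrak R$-modules $U,U'$ are equivalent if there is an $\mathfrak R$-linear isomorphism $\nu:U\to U'$ with $\rho'(b)=\nu\rho(b)\nu^{-1}$ for all $b$. *)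

(* Defs.v *)
From HB Require Import structures.
From mathcomp Require Import all_boot all_order all_algebra all_fingroup.
From mathcomp Require Import generic_quotient fraction.
From mathcomp Require Import boolp reals trigo.
From mathcomp.multinomials Require Import freeg.
From mathcomp Require Import zify ring.

Set Implicit Arguments.
Unset Strict Implicit.
Unset Printing Implicit Defensive.

Import Order.TTheory GRing.Theory Num.Theory.
Local Open Scope ring_scope.
Local Open Scope quotient_scope.

(* Z[x,y] is {poly {poly int}}: the inner variable is x, the outer one is y.
   Laurent polynomials are the fractions P / (x^m y^n). *)
Notation Zxy := {poly {poly int}}.

Definition fracX : {fraction Zxy} := tofrac ('X%:P : Zxy).
Definition fracY : {fraction Zxy} := tofrac ('X : Zxy).

Definition is_laurent : {pred {fraction Zxy}} := fun f =>
  `[< exists (P : Zxy) (m n : nat), f = tofrac P / (fracX ^+ m * fracY ^+ n) >].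

Lemma is_laurentP f :
  reflect (exists (P : Zxy) (m n : nat),
             f = tofrac P / (fracX ^+ m * fracY ^+ n))
          (f \in is_laurent).
Proof. exact: asboolP. Qed.

Lemma fracX_neq0 : fracX != 0.
Proof. by rewrite tofrac_eq0 polyC_eq0 polyX_eq0. Qed.

Lemma fracY_neq0 : fracY != 0.
Proof. by rewrite tofrac_eq0 polyX_eq0. Qed.

Section FractionsWithPowerDenominators.
Variables (A : comNzRingType) (F : fieldType) (f : {rmorphism A -> F}) (x y : A).
Hypotheses (fx0 : f x != 0) (fy0 : f y != 0).

Let is_frac z := exists (P : A) (m n : nat), z = f P / (f x ^+ m * f y ^+ n).

Fact power_denom1 : is_frac 1.
Proof. by exists 1, 0%N, 0%N; rewrite rmorph1 !expr0 mulr1 divr1. Qed.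

Fact power_denomB u v : is_frac u -> is_frac v -> is_frac (u - v).
Proof.
have xy0 m n : f x ^+ m * f y ^+ n != 0 by rewrite mulf_neq0 ?expf_neq0.
move=> [P [m [n ->]]] [Q [k [l ->]]].
exists (P * (x ^+ k * y ^+ l) - Q * (x ^+ m * y ^+ n)), (m + k)%N, (n + l)%N.
rewrite rmorphB !rmorphM !rmorphXn !exprD -[f P / _ - _]/(f P / _ + - (f Q / _)).
by rewrite -[- (f Q / _)]mulNr addf_div // mulNr [f x ^+ m * _ * _]mulrACA.
Qed.

Fact power_denomM u v : is_frac u -> is_frac v -> is_frac (u * v).
Proof.
move=> [P [m [n ->]]] [Q [k [l ->]]]; exists (P * Q), (m + k)%N, (n + l)%N.
by rewrite rmorphM !exprD mulf_div [f x ^+ m * _ * _]mulrACA.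
Qed.

End FractionsWithPowerDenominators.

Lemma is_laurent_subring : subring_closed is_laurent.
Proof.
split=> [|u v /is_laurentP uL /is_laurentP vL|u v /is_laurentP uL /is_laurentP vL].
- apply/is_laurentP; exact: (@power_denom1 _ _ (@tofrac Zxy)).
- apply/is_laurentP.
  exact: (@power_denomB _ _ (@tofrac Zxy) _ _ fracX_neq0 fracY_neq0).
- apply/is_laurentP; exact: (@power_denomM _ _ (@tofrac Zxy)).
Qed.

HB.instance Definition _ :=
  GRing.isSubringClosed.Build {fraction Zxy} is_laurent is_laurent_subring.

Record laurent := Laurent {
  laurent_val :> {fraction Zxy};
  _ : laurent_val \in is_laurent }.

HB.instance Definition _ := [isSub for laurent_val].
HB.instance Definition _ := [Choice of laurent by <:].
HB.instance Definition _ := [SubChoice_isSubComNzRing of laurent by <:].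

Section SubringUnits.
Variables (F : fieldType) (S : pred F) (L : subComNzRingType S).

Definition sub_unit : pred L := fun u => (u != 0) && ((val u)^-1 \in S).

Definition sub_inv (u : L) : L := insubd u (val u)^-1.

Lemma sub_val_eq0 (u : L) : (val u == 0) = (u == 0).
Proof. by rewrite -(inj_eq val_inj) rmorph0. Qed.

Fact sub_mulVr : {in sub_unit, left_inverse 1 sub_inv *%R}.
Proof.
move=> u /andP[u0 uV]; apply/val_inj.
have uE : val (sub_inv u) = (val u)^-1 by rewrite val_insubd [S _]uV.
have -> : val (sub_inv u * u) = val (sub_inv u) * val u by exact: rmorphM.
by rewrite uE mulVf ?sub_val_eq0 // rmorph1.
Qed.

Fact sub_intro_unit (u v : L) : v * u = 1 -> sub_unit u.
Proof.
move=> vu1; have vu1' : val v * val u = 1 by rewrite -rmorphM vu1 rmorph1.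
have u0 : val u != 0.
  by apply/eqP => u0; move/eqP: vu1'; rewrite u0 mulr0 eq_sym oner_eq0.
apply/andP; split; first by rewrite -sub_val_eq0.
by rewrite (_ : (val u)^-1 = val v) ?[_ \in _](valP v) // -[LHS]mul1r -vu1' mulfK.
Qed.

Fact sub_inv_out : {in [predC sub_unit], sub_inv =1 id}.
Proof.
move=> u; rewrite inE /= [_ \in _]/(sub_unit u) /sub_unit negb_and negbK.
case/orP=> [/eqP ->|uV]; apply/val_inj; rewrite val_insubd.
  by rewrite rmorph0 invr0 if_same.
by rewrite -[S _]/(_ \in S) (negPf uV).
Qed.

End SubringUnits.

HB.instance Definition _ :=
  GRing.ComNzRing_hasMulInverse.Build laurent
    (@sub_mulVr _ _ laurent) (@sub_intro_unit _ _ laurent)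
    (@sub_inv_out _ _ laurent).

Fact laurent_x_subproof : fracX \in is_laurent.
Proof. by apply/is_laurentP; exists 'X%:P, 0%N, 0%N; rewrite !expr0 mulr1 divr1. Qed.

Fact laurent_y_subproof : fracY \in is_laurent.
Proof. by apply/is_laurentP; exists 'X, 0%N, 0%N; rewrite !expr0 mulr1 divr1. Qed.

Definition laurent_x : laurent := Laurent laurent_x_subproof.
Definition laurent_y : laurent := Laurent laurent_y_subproof.

Lemma laurent_x_unit : laurent_x \is a GRing.unit.
Proof.
apply/andP; split; first by rewrite -sub_val_eq0 fracX_neq0.
by apply/is_laurentP; exists 1, 1%N, 0%N; rewrite tofrac1 expr0 mulr1 expr1 mul1r.
Qed.

Lemma laurent_y_unit : laurent_y \is a GRing.unit.
Proof.
apply/andP; split; first by rewrite -sub_val_eq0 fracY_neq0.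
by apply/is_laurentP; exists 1, 0%N, 1%N; rewrite tofrac1 expr0 mul1r expr1 mul1r.
Qed.

Section ArtinGroup.
Variables (I : finType) (m : I -> I -> nat).

(* The letter (i, false) stands for s_i and (i, true) for its inverse. *)
Notation word := (seq (I * bool)).

Definition inv_letter (l : I * bool) : I * bool := (l.1, ~~ l.2).

Fixpoint alt_word (i j : I) (k : nat) : word :=
  if k is k'.+1 then (i, false) :: alt_word j i k' else [::].

Inductive artin_eq : word -> word -> Prop :=
| artin_eq_refl u : artin_eq u u
| artin_eq_sym u v : artin_eq u v -> artin_eq v u
| artin_eq_trans v u w : artin_eq u v -> artin_eq v w -> artin_eq u w
| artin_eq_cat u u' v v' :
    artin_eq u u' -> artin_eq v v' -> artin_eq (u ++ v) (u' ++ v')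
| artin_eq_cancel l : artin_eq [:: l; inv_letter l] [::]
| artin_eq_braid i j : artin_eq (alt_word i j (m i j)) (alt_word j i (m i j)).

Definition artin_eqb : rel word := fun u v => `[< artin_eq u v >].

Fact artin_eqb_equiv : equiv_class_of artin_eqb.
Proof.
split=> [u|u v|v u w].
- by apply/asboolP; apply: artin_eq_refl.
- by apply/asboolP/asboolP; apply: artin_eq_sym.
- by move=> /asboolP uv /asboolP vw; apply/asboolP; apply: artin_eq_trans vw.
Qed.

Canonical artin_eqb_rel := EquivRelPack artin_eqb_equiv.

Definition artin := {eq_quot artin_eqb}.

HB.instance Definition _ := Choice.on artin.
HB.instance Definition _ := EqQuotient.on artin.

Definition artin_class (u : word) : artin := \pi_artin u.

Lemma artin_classP u v : reflect (artin_eq u v) (artin_class u == artin_class v).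
Proof. by rewrite piE /=; apply: asboolP. Qed.

Lemma artin_classE u v : artin_eq u v -> artin_class u = artin_class v.
Proof. by move/artin_classP/eqP. Qed.

Lemma artin_reprK : cancel (@repr _ artin) artin_class.
Proof. exact: reprK. Qed.

Lemma repr_artin_class u : artin_eq (repr (artin_class u)) u.
Proof. by apply/artin_classP; rewrite artin_reprK. Qed.

Definition inv_word (u : word) : word := rev (map inv_letter u).

Definition artin_mul (x y : artin) : artin := artin_class (repr x ++ repr y).
Definition artin_one : artin := artin_class [::].
Definition artin_inv (x : artin) : artin := artin_class (inv_word (repr x)).

Lemma artin_mul_class u v :
  artin_mul (artin_class u) (artin_class v) = artin_class (u ++ v).
Proof. by apply: artin_classE; apply: artin_eq_cat; apply: repr_artin_class. Qed.

Lemma inv_letterK : involutive inv_letter.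
Proof. by case=> i b; rewrite /inv_letter /= negbK. Qed.

Lemma inv_wordK : involutive inv_word.
Proof. by move=> u; rewrite /inv_word map_rev revK -map_comp map_id_in // => l _ /=; rewrite inv_letterK. Qed.

Lemma artin_eq_invr u : artin_eq (u ++ inv_word u) [::].
Proof.
elim: u => [|l u IHu]; first exact: artin_eq_refl.
rewrite /inv_word /= rev_cons -cats1 catA -[l :: _]cat1s -!catA.
apply: (@artin_eq_trans ([:: l] ++ ([::] ++ [:: inv_letter l]))).
  apply: artin_eq_cat; first exact: artin_eq_refl.
  by rewrite catA; apply: artin_eq_cat => //; apply: artin_eq_refl.
exact: artin_eq_cancel.
Qed.

Fact artin_mulA : associative artin_mul.
Proof.
move=> x y z; rewrite -[x]artin_reprK -[y]artin_reprK -[z]artin_reprK.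
by rewrite !artin_mul_class catA.
Qed.

Fact artin_mul1 : left_id artin_one artin_mul.
Proof. by move=> x; rewrite -[x]artin_reprK artin_mul_class. Qed.

Fact artin_mulr1 : right_id artin_one artin_mul.
Proof. by move=> x; rewrite -[x]artin_reprK artin_mul_class cats0. Qed.

Fact artin_mulrV : right_inverse artin_one artin_inv artin_mul.
Proof.
move=> x; rewrite -{1}[x]artin_reprK artin_mul_class.
exact/artin_classE/artin_eq_invr.
Qed.

Fact artin_mulVr : left_inverse artin_one artin_inv artin_mul.
Proof.
move=> x; rewrite -{2}[x]artin_reprK artin_mul_class.
by apply/artin_classE; rewrite -{2}[repr x]inv_wordK; apply: artin_eq_invr.
Qed.

HB.instance Definition _ :=
  isGroup.Build artin artin_mulA artin_mul1 artin_mulr1 artin_mulVr artin_mulrV.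

Definition artin_gen (i : I) : artin := artin_class [:: (i, false)].

Lemma artin_classM u v : artin_class (u ++ v) = (artin_class u * artin_class v)%g.
Proof. by rewrite -[RHS]/(artin_mul _ _) artin_mul_class. Qed.

Lemma artin_class_nil : artin_class [::] = 1%g.
Proof. by []. Qed.

End ArtinGroup.

Section ArtinLift.
Variables (I : finType) (m : I -> I -> nat) (H : groupType) (h : I -> H).

Fixpoint word_eval (u : seq (I * bool)) : H :=
  if u is l :: u' then
    ((if l.2 then (h l.1)^-1 else h l.1) * word_eval u')%g
  else 1%g.

Fixpoint alt_prod (x y : H) (k : nat) : H :=
  if k is k'.+1 then (x * alt_prod y x k')%g else 1%g.

(* The value does not depend on the representative as soon as h respects the
   defining relations; artin_liftM and artin_lift_gen then say that
   artin_lift is the homomorphism sending s_i to h i. *)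
Definition artin_lift (x : artin m) : H := word_eval (repr x).

Lemma word_eval_cat u v : word_eval (u ++ v) = (word_eval u * word_eval v)%g.
Proof. by elim: u => [|l u IHu] /=; rewrite ?mul1g // IHu mulgA. Qed.

Lemma word_eval_alt i j k : word_eval (alt_word i j k) = alt_prod (h i) (h j) k.
Proof. by elim: k i j => //= k IHk i j; rewrite IHk. Qed.

Hypothesis hm :
  forall i j, alt_prod (h i) (h j) (m i j) = alt_prod (h j) (h i) (m i j).

Lemma word_eval_eq u v : artin_eq m u v -> word_eval u = word_eval v.
Proof.
elim=> //= [v' u' w _ -> _ -> //|u1 u2 v1 v2 _ E1 _ E2|l|i j].
- by rewrite !word_eval_cat E1 E2.
- by case: l => i [] /=; rewrite mulg1 ?mulVg ?mulgV.
- by rewrite !word_eval_alt hm.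
Qed.

Lemma artin_lift_class u : artin_lift (artin_class m u) = word_eval u.
Proof. exact/word_eval_eq/repr_artin_class. Qed.

Lemma artin_liftM x y : artin_lift (x * y)%g = (artin_lift x * artin_lift y)%g.
Proof.
rewrite -{1}[x]artin_reprK -{1}[y]artin_reprK -artin_classM.
by rewrite artin_lift_class word_eval_cat.
Qed.

Lemma artin_lift_gen i : artin_lift (artin_gen m i) = h i.
Proof. by rewrite artin_lift_class /= mulg1. Qed.

End ArtinLift.

Lemma artin_braid (I : finType) (m : I -> I -> nat) i j :
  alt_prod (artin_gen m i) (artin_gen m j) (m i j)
  = alt_prod (artin_gen m j) (artin_gen m i) (m i j).
Proof.
have E k i' j' : artin_class m (alt_word i' j' k)
                 = alt_prod (artin_gen m i') (artin_gen m j') k.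
  elim: k i' j' => [|k IHk] i' j' //=.
  by rewrite -IHk -[_ :: _]cat1s artin_classM.
by rewrite -!E; apply/artin_classE/artin_eq_braid.
Qed.

Lemma artin_comm (I : finType) (m : I -> I -> nat) i j : m i j = 2%N ->
  commute (artin_gen m i) (artin_gen m j).
Proof. by move=> mij; have := artin_braid m i j; rewrite mij /= !mulg1. Qed.

Lemma artin_braid3 (I : finType) (m : I -> I -> nat) i j : m i j = 3%N ->
  (artin_gen m i * artin_gen m j * artin_gen m i
   = artin_gen m j * artin_gen m i * artin_gen m j)%g.
Proof. by move=> mij; have := artin_braid m i j; rewrite mij /= !mulg1 !mulgA. Qed.

Record small_coxeter (I : finType) := SmallCoxeter {
  cox :> I -> I -> nat;
  cox_sym : forall i j, cox i j = cox j i;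
  cox_small : forall i j, cox i j \in [:: 1; 2; 3]%N;
  cox_diag : forall i j, (cox i j == 1%N) = (i == j) }.

Section Roots.
Variables (K : realType) (I : finType) (m : small_coxeter I).

Notation E := {ffun I -> K}.

Definition simple_root (i : I) : E := [ffun j => (i == j)%:R].

Definition root_form (u v : E) : K :=
  \sum_i \sum_j u i * v j * (- 2 * cos (pi / (m i j)%:R)).

Definition refl (i : I) (u : E) : E :=
  [ffun j => u j - root_form u (simple_root i) * simple_root i j].

(* W is the group of the transformations of E given by words in the s_i. *)
Definition word_act (s : seq I) : E -> E := fun u => foldr refl u s.

Definition has_length (w : E -> E) (k : nat) : Prop :=
  (exists2 s, w = word_act s & size s = k)
  /\ (forall s, w = word_act s -> (k <= size s)%N).

Definition is_root (u : E) : Prop :=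
  exists (s : seq I) (i : I), u = word_act s (simple_root i).

Definition is_posroot : pred E := fun u => `[< is_root u >] && [forall i, 0 <= u i].

Definition is_negroot : pred E := fun u => is_posroot (- u).

Record posroot := PosRoot { posroot_val :> E; _ : is_posroot posroot_val }.

HB.instance Definition _ := [isSub for posroot_val].
HB.instance Definition _ := [Choice of posroot by <:].

Fact simple_posroot_subproof i : is_posroot (simple_root i).
Proof.
apply/andP; split; first by apply/asboolP; exists [::], i.
by apply/forallP => j; rewrite ffunE ler0n.
Qed.

Definition simple_posroot i : posroot := PosRoot (simple_posroot_subproof i).

Lemma root_form_simple i j :
  root_form (simple_root i) (simple_root j) = - 2 * cos (pi / (m i j)%:R).
Proof.
rewrite /root_form (bigD1 i) //= [X in _ + X]big1 => [|k ki]; last first.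
  by rewrite big1 // => l _; rewrite !ffunE eq_sym (negPf ki) !mul0r.
rewrite (bigD1 j) //= [X in _ + X + _]big1 => [|k kj]; last first.
  by rewrite !ffunE [j == k]eq_sym (negPf kj) mulr0 mul0r.
by rewrite !ffunE !eqxx !addr0 !mul1r.
Qed.

Lemma root_form_linl (u v w : E) x :
  root_form [ffun j => u j - x * v j] w = root_form u w - x * root_form v w.
Proof.
rewrite mulr_sumr -sumrB; apply: eq_bigr => i _; rewrite mulr_sumr -sumrB.
by apply: eq_bigr => j _; rewrite ffunE !mulrBl !mulrA.
Qed.

Lemma root_form_simple2 i : root_form (simple_root i) (simple_root i) = 2.
Proof.
have /eqP mii : m i i == 1%N by rewrite cox_diag.
by rewrite root_form_simple mii divr1 cospi mulrNN mulr1.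
Qed.

Lemma refl_simple i : refl i (simple_root i) = - simple_root i.
Proof.
by apply/ffunP => j; rewrite !ffunE root_form_simple2; case: eqP => _ /=; ring.
Qed.

Lemma reflK i : involutive (refl i).
Proof.
move=> u; apply/ffunP => j.
rewrite !ffunE root_form_linl root_form_simple2; ring.
Qed.

Lemma word_act_cat s t u : word_act (s ++ t) u = word_act s (word_act t u).
Proof. exact: foldr_cat. Qed.

Lemma word_act_revK s : cancel (word_act s) (word_act (rev s)).
Proof.
elim: s => [|i s IHs] u //=.
by rewrite rev_cons -cats1 word_act_cat /= reflK IHs.
Qed.

Lemma has_length_ex s : exists2 k, has_length (word_act s) k & (k <= size s)%N.
Proof.
pose P k := `[< exists2 t, word_act s = word_act t & size t = k >].
have exP : exists k, P k by exists (size s); apply/asboolP; exists s.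
case: (ex_minnP exP) => k /asboolP Pk kmin; exists k.
  by split=> // t st; apply: kmin; apply/asboolP; exists t.
by apply: kmin; apply/asboolP; exists s.
Qed.

Definition depth_pred (u : E) : pred nat := fun k =>
  `[< exists2 w : E -> E, has_length w k & is_negroot (w u) >].

Fact depth_ex (r : posroot) : exists k, depth_pred r k.
Proof.
have /andP[/asboolP[s [i rE]] _] := valP r.
have [k sk _] := has_length_ex (i :: rev s); exists k; apply/asboolP.
exists (word_act (i :: rev s)) => //.
rewrite /= rE -[refl i _]/(refl i (word_act (rev s) _)) word_act_revK.
by rewrite refl_simple /is_negroot opprK simple_posroot_subproof.
Qed.

Definition depth (r : posroot) : nat := ex_minn (depth_ex r).

End Roots.

Section LinearRepresentations.
Variables (R : comUnitRingType) (G : groupType).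

Record linrep (V : lmodType R) := LinRep {
  linrep_fun :> G -> {linear V -> V};
  linrep1 : forall v, linrep_fun 1%g v = v;
  linrepM : forall x y v,
    linrep_fun (x * y)%g v = linrep_fun x (linrep_fun y v) }.

Definition rep_equiv (U U' : lmodType R) (rho : linrep U) (rho' : linrep U') :=
  exists nu : {linear U -> U'},
    bijective nu /\ forall x u, rho' x (nu u) = nu (rho x u).

End LinearRepresentations.

Section LinearExtension.
Variables (R : comUnitRingType) (X : choiceType) (U : lmodType R) (f : X -> U).

Definition free_ext : {freeg X / R} -> U := fglift f.

Fact free_extB u v : free_ext (u - v) = free_ext u - free_ext v.
Proof. exact: lift_is_additive. Qed.

Fact free_extD u v : free_ext (u + v) = free_ext u + free_ext v.
Proof.
have free_extN w : free_ext (- w) = - free_ext w.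
  by rewrite -[in LHS]sub0r free_extB -[X in free_ext X](subrr 0) free_extB subrr sub0r.
by rewrite -[in LHS](opprK v) free_extB free_extN opprK.
Qed.

Fact free_extZ a u : free_ext (a *: u) = a *: free_ext u.
Proof.
have free_ext_sum s (F : X -> {freeg X / R}) :
    free_ext (\sum_(x <- s) F x) = \sum_(x <- s) free_ext (F x).
  apply: (big_morph free_ext free_extD).
  by rewrite -[X in free_ext X](subrr 0) free_extB subrr.
rewrite -[u]freeg_sumE scaler_sumr !free_ext_sum scaler_sumr.
apply: eq_bigr => x _; rewrite /free_ext liftU scalerA -(liftU f); congr (fglift f _).
by apply/eqP/freeg_eqP => y; rewrite coeffZ !coeffU mulrA.
Qed.

Fact free_ext_linear : linear free_ext.
Proof. by move=> a u v; rewrite free_extD free_extZ. Qed.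

HB.instance Definition _ :=
  GRing.isLinear.Build R {freeg X / R} U *:%R free_ext free_ext_linear.

Lemma free_extU x : free_ext << x >> = f x.
Proof. by rewrite /free_ext liftU scale1r. Qed.

End LinearExtension.

Section LKRepresentations.
Variables (K : realType) (I : finType) (m : small_coxeter I).
Variables (R : comUnitRingType) (b c d : R).

Notation posroot := (posroot K m).

Definition lkmod := {freeg posroot / R}.
HB.instance Definition _ := GRing.Lmodule.on lkmod.

Definition ebasis (r : posroot) : lkmod := << r >>.

Definition lk_a : R := d - b * c / d.

(* When r is neither alpha_i nor fixed by s_i, the root s_i(r) is positive, and
   its depth differs from that of r; the None branch is never reached. *)
Definition phi_basis (i : I) (r : posroot) : lkmod :=
  if val r == simple_root K i then 0
  else if refl m i (val r) == val r then d *: ebasis r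
  else if insub (refl m i (val r)) is Some s then
    if (depth r < depth s)%N then lk_a *: ebasis r + c *: ebasis s
    else b *: ebasis s
  else 0.

Definition phi (i : I) : {linear lkmod -> lkmod} := free_ext (phi_basis i).

Lemma phiE i r : phi i (ebasis r) = phi_basis i r.
Proof. exact: free_extU. Qed.

Lemma phi_simple i : phi i (ebasis (simple_posroot K m i)) = 0.
Proof. by rewrite phiE /phi_basis eqxx. Qed.

Lemma phi_fixed i r : refl m i (val r) = val r -> phi i (ebasis r) = d *: ebasis r.
Proof.
move=> rfix; rewrite phiE /phi_basis rfix eqxx.
case: eqP => // rE; move: rfix; rewrite rE refl_simple => /ffunP/(_ i).
rewrite !ffunE eqxx => /eqP; rewrite -subr_eq0 -opprD oppr_eq0.
by rewrite -natrD pnatr_eq0.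
Qed.

Lemma phi_up i r s : val s = refl m i (val r) -> (depth r < depth s)%N ->
  phi i (ebasis s) = b *: ebasis r /\
  phi i (ebasis r) = lk_a *: ebasis r + c *: ebasis s.
Proof.
have pos_nsimple (t u : posroot) : val u = refl m i (val t) ->
    (val t == simple_root K i) = false.
  move=> uE; apply/eqP => tE; move: uE; rewrite tE refl_simple => uE.
  have /andP[_ /forallP/(_ i)] := valP u; rewrite uE !ffunE eqxx.
  by rewrite oppr_ge0 ler10.
move=> sE rs; have rE : val r = refl m i (val s) by rewrite sE reflK.
have sr : (val s == val r) = false.
  by apply/eqP => /val_inj sr; rewrite sr ltnn in rs.
rewrite !phiE /phi_basis (pos_nsimple _ _ sE) (pos_nsimple _ _ rE) -rE -sE.
by rewrite eq_sym sr !valK rs ltnNge (ltnW rs).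
Qed.

Definition LK_family (f : I -> {scalar lkmod}) : Prop :=
  [/\ forall i j, i != j -> f i (ebasis (simple_posroot K m j)) = 0,
      forall i j, m i j = 2%N -> forall v, f i (phi j v) = d * f i v
    & forall i j, m i j = 3%N -> forall v, f i (phi j v) = f j (phi i v)].

Definition LK_rep (psi : linrep (artin m) lkmod) : Prop :=
  exists f : I -> {scalar lkmod},
    [/\ LK_family f,
        forall i, f i (ebasis (simple_posroot K m i)) \is a GRing.unit
      & forall i v, psi (artin_gen m i) v
          = phi i v + f i v *: ebasis (simple_posroot K m i)].

End LKRepresentations.

Section Twisted.
Variables (K : realType) (I : finType) (m : small_coxeter I) (R : comUnitRingType).

Definition graph_aut (g : {perm I}) : Prop := forall i j, m (g i) (g j) = m i j.

(* The linear action on E with alpha_i |-> alpha_(g i). *)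
Definition perm_vec (g : {perm I}) (u : {ffun I -> K}) : {ffun I -> K} :=
  [ffun i => u ((g^-1)%g i)].

(* For a graph automorphism g the default value is not used: see root_actE. *)
Definition root_act (g : {perm I}) (r : posroot K m) : posroot K m :=
  insubd r (perm_vec g (val r)).

Lemma perm_vec_simple g i : perm_vec g (simple_root K i) = simple_root K (g i).
Proof.
apply/ffunP => j; rewrite !ffunE; congr (_%:R); congr nat_of_bool.
by apply/eqP/eqP => [->|<-]; rewrite ?permKV ?permK.
Qed.

Lemma root_form_perm g u v : graph_aut g ->
  root_form m (perm_vec g u) (perm_vec g v) = root_form m u v.
Proof.
move=> gm; rewrite /root_form (reindex_inj (@perm_inj _ g)) /=.
apply: eq_bigr => i _; rewrite (reindex_inj (@perm_inj _ g)) /=.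
by apply: eq_bigr => j _; rewrite !ffunE !permK gm.
Qed.

Lemma perm_vec_refl g i u : graph_aut g ->
  perm_vec g (refl m i u) = refl m (g i) (perm_vec g u).
Proof.
move=> gm; rewrite /refl -(perm_vec_simple g) root_form_perm //.
by apply/ffunP => j; rewrite !ffunE.
Qed.

Lemma perm_vec_posroot g u : graph_aut g ->
  is_posroot m u -> is_posroot m (perm_vec g u).
Proof.
move=> gm /andP[/asboolP[s [i ->]] /forallP pos]; apply/andP; split.
  apply/asboolP; exists (map g s), (g i); rewrite -perm_vec_simple.
  by elim: s {pos} => //= j s IHs; rewrite perm_vec_refl // IHs.
by apply/forallP => j; rewrite ffunE.
Qed.

Lemma root_actE g r : graph_aut g -> val (root_act g r) = perm_vec g (val r).
Proof. by move=> gm; rewrite val_insubd perm_vec_posroot ?(valP r). Qed.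

Definition mod_act (g : {perm I}) : {linear lkmod K m R -> lkmod K m R} :=
  free_ext (fun r => ebasis R (root_act g r)).

Lemma mod_actE g r : mod_act g (ebasis R r) = ebasis R (root_act g r).
Proof. exact: free_extU. Qed.

Section Fixed.
Variable G : {group {perm I}}.

Definition fix_pred : {pred lkmod K m R} :=
  fun v => [forall g in G, mod_act g v == v].

Fact fix_pred_submod : submod_closed fix_pred.
Proof.
split=> [|a u v /forall_inP uG /forall_inP vG]; apply/forall_inP => g gG.
  by rewrite linear0.
by rewrite linearP (eqP (uG g gG)) (eqP (vG g gG)).
Qed.

HB.instance Definition _ :=
  GRing.isSubmodClosed.Build R (lkmod K m R) fix_pred fix_pred_submod.

Record fixmod := FixMod { fixmod_val :> lkmod K m R; _ : fixmod_val \in fix_pred }.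

HB.instance Definition _ := [isSub for fixmod_val].
HB.instance Definition _ := [Choice of fixmod by <:].
HB.instance Definition _ := [SubChoice_isSubLmodule of fixmod by <:].

(* With B identified through iota : B -> B_Gamma with the fixed elements of
   B_Gamma, rho is the restriction of psi(b), b in B, to the submodule V^G. *)
Definition twisted_rep (B : groupType) (iota : B -> artin m)
    (psi : linrep (artin m) (lkmod K m R)) (rho : linrep B fixmod) : Prop :=
  forall b v, val (rho b v) = psi (iota b) (val v).

End Fixed.
End Twisted.

(* Vertices are numbered from 0: the vertex i of the usual labelling 1, 2, ...
   is the ordinal i - 1. *)

Section BraidIdentities.
Variable H : groupType.
Implicit Types a b c d : H.
Local Open Scope group_scope.

Let mulA (x y z : H) : (x * y) * z = x * (y * z) := esym (mulgA x y z).

Let mulCA a b : a * b = b * a -> forall z, a * (b * z) = b * (a * z).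
Proof. by move=> ab z; rewrite !mulgA ab. Qed.

Let braidA a b : a * b * a = b * a * b ->
  forall z, a * (b * (a * z)) = b * (a * (b * z)).
Proof. by move=> ab z; rewrite !mulgA ab. Qed.

Lemma alt_prod_comm a b : commute a b -> alt_prod a b 2 = alt_prod b a 2.
Proof. by rewrite /= !mulg1. Qed.

Lemma alt_prod_braid3 a a' b b' :
    a * b * a = b * a * b -> a' * b' * a' = b' * a' * b' ->
    a * a' = a' * a -> a * b' = b' * a -> b * a' = a' * b -> b * b' = b' * b ->
  alt_prod (a * a') (b * b') 3 = alt_prod (b * b') (a * a') 3.
Proof.
move=> ab ab' aa' Cab' ba' bb'; rewrite /= !mulg1 !mulA.
transitivity (b * (a * (b * (b' * (a' * b'))))).
  rewrite (mulCA (esym ba')) (mulCA (esym Cab')) (mulCA (esym aa')) (braidA ab).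
  by rewrite -[a' * (b' * a')]mulA ab' !mulA.
by rewrite (mulCA (esym Cab')) (mulCA (esym ba')) (mulCA (esym bb')).
Qed.

Lemma alt_prod_braid4 a b c :
    a * b = b * a -> a * c * a = c * a * c -> b * c * b = c * b * c ->
  alt_prod (a * b) c 4 = alt_prod c (a * b) 4.
Proof.
move=> ab ac bc; rewrite /= !mulg1 !mulA.
rewrite [a * (b * c) in LHS](mulCA ab) (braidA bc).
rewrite -[c * (a * c) in LHS]mulA -ac !mulA.
by rewrite [b * (a * (c * a))](mulCA (esym ab)) (braidA ac) (braidA (esym bc)) ab.
Qed.

End BraidIdentities.

Section TypeA.
Variable N : nat.

Definition coxA_fun (i j : 'I_N) : nat :=
  if i == j then 1 else if (i.+1 == j) || (j.+1 == i) then 3 else 2.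

Fact coxA_sym i j : coxA_fun i j = coxA_fun j i.
Proof. by rewrite /coxA_fun eq_sym orbC. Qed.

Fact coxA_small i j : coxA_fun i j \in [:: 1; 2; 3]%N.
Proof. by rewrite /coxA_fun; do 2?case: ifP. Qed.

Fact coxA_diag i j : (coxA_fun i j == 1%N) = (i == j).
Proof. by rewrite /coxA_fun; do 2?case: ifP. Qed.

Definition coxA : small_coxeter 'I_N := SmallCoxeter coxA_sym coxA_small coxA_diag.

(* i |-> N + 1 - i in the labelling 1, ..., N. *)
Definition autA : {perm 'I_N} := perm (@rev_ord_inj N).

Lemma coxA_far (i j : 'I_N) : (i.+1 < j)%N || (j.+1 < i)%N -> coxA i j = 2%N.
Proof. by move=> ij; rewrite /= /coxA_fun -val_eqE /=; do 2?[case: ifP; first lia]. Qed.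

Lemma coxA_next (i j : 'I_N) : (i.+1 == j) || (j.+1 == i) -> coxA i j = 3%N.
Proof. by move=> ij; rewrite /= /coxA_fun ij -val_eqE /=; case: ifP => //; lia. Qed.

Lemma autA_val (i : 'I_N) : autA i = (N - i.+1)%N :> nat.
Proof. by rewrite permE. Qed.

Lemma autA_graph : graph_aut coxA autA.
Proof.
move=> i j; rewrite /= /coxA_fun (inj_eq perm_inj) !permE /=.
by case: ifP => // _; congr (if _ then _ else _); case: i j => i Hi [j Hj] /=; lia.
Qed.

End TypeA.

Section TypeD.
Variable n : nat.

(* D_(n+1): the chain 1, ..., n, together with an edge from n - 1 to n + 1. *)
Definition adjD (i j : nat) : bool :=
  ((j == i.+1) && (j < n)%N) || ((i.+2 == n) && (j == n)).

Definition coxD_fun (i j : 'I_n.+1) : nat :=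
  if i == j then 1 else if adjD i j || adjD j i then 3 else 2.

Fact coxD_sym i j : coxD_fun i j = coxD_fun j i.
Proof. by rewrite /coxD_fun eq_sym orbC. Qed.

Fact coxD_small i j : coxD_fun i j \in [:: 1; 2; 3]%N.
Proof. by rewrite /coxD_fun; do 2?case: ifP. Qed.

Fact coxD_diag i j : (coxD_fun i j == 1%N) = (i == j).
Proof. by rewrite /coxD_fun; do 2?case: ifP. Qed.

Definition coxD : small_coxeter 'I_n.+1 :=
  SmallCoxeter coxD_sym coxD_small coxD_diag.

Definition autD : {perm 'I_n.+1} := tperm (inord n.-1) ord_max.

Lemma coxD_comm (i j : 'I_n.+1) : i != j -> ~~ adjD i j -> ~~ adjD j i -> coxD i j = 2%N.
Proof. by rewrite /= /coxD_fun => /negPf-> /negPf-> /negPf->. Qed.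

Lemma coxD_adj (i j : 'I_n.+1) : adjD i j || adjD j i -> coxD i j = 3%N.
Proof.
move=> ij; rewrite /= /coxD_fun ij; case: eqP => // /(congr1 val) /= E.
by move: ij; rewrite /adjD E; lia.
Qed.

Lemma autD_graph : (0 < n)%N -> graph_aut coxD autD.
Proof.
move=> n_gt0 i j; rewrite /= /coxD_fun (inj_eq perm_inj).
have autDE (k : 'I_n.+1) : autD k = (if k == n.-1 :> nat then n
                                   else if k == n :> nat then n.-1 else k) :> nat.
  have kn := ltn_ord k; have n1 : (n.-1 < n.+1)%N by lia.
  have E1 : (k == inord n.-1) = (k == n.-1 :> nat) by rewrite -val_eqE /= inordK.
  have E2 : (k == ord_max) = (k == n :> nat) by rewrite -val_eqE.
  rewrite permE /= E1 E2; case: ifP => // _; case: ifP => // _.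
  by rewrite inordK.
case: ifP => // ij; congr (if _ then _ else _).
have := ltn_ord i; have := ltn_ord j; move: ij; rewrite -val_eqE /= /adjD !autDE.
by do 4?case: ifP; lia.
Qed.

End TypeD.

Section TypeB.
Variable n : nat.

Definition coxB (i j : 'I_n) : nat :=
  if i == j then 1
  else if (i.+1 == j) || (j.+1 == i) then
    if (i.+1 == n) || (j.+1 == n) then 4 else 3
  else 2.

Fact widenA_subproof : (n <= n.*2.-1)%N.
Proof. by case: n => // k; rewrite doubleS /= -addnn ltnS leq_addr. Qed.

(* Delta_i |-> s_i s_(2n-i) for i < n, and Delta_n |-> s_n. *)
Definition genBA (i : 'I_n) : artin (coxA n.*2.-1) :=
  let j := widen_ord widenA_subproof i in
  if (i.+1 < n)%N then (artin_gen _ j * artin_gen _ (autA _ j))%g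
  else artin_gen _ j.

(* Delta_i |-> s_i for i < n, and Delta_n |-> s_n s_(n+1). *)
Definition genBD (i : 'I_n) : artin (coxD n) :=
  let j := widen_ord (leqnSn n) i in
  if (i.+1 < n)%N then artin_gen _ j
  else (artin_gen _ j * artin_gen _ ord_max)%g.

Fact coxB_rel_ind (H : groupType) (h : 'I_n -> H) :
    (forall i j : 'I_n, (i.+1 < j)%N -> commute (h i) (h j)) ->
    (forall i j : 'I_n, i.+1 = j -> (j.+1 < n)%N ->
       alt_prod (h i) (h j) 3 = alt_prod (h j) (h i) 3) ->
    (forall i j : 'I_n, i.+1 = j -> j.+1 = n ->
       alt_prod (h i) (h j) 4 = alt_prod (h j) (h i) 4) ->
  forall i j, alt_prod (h i) (h j) (coxB i j) = alt_prod (h j) (h i) (coxB i j).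
Proof.
move=> h2 h3 h4 i j.
wlog ij : i j / (i <= j)%N => [hwlog|].
  case/orP: (leq_total i j) => [|ji]; first exact: hwlog.
  suff -> : coxB i j = coxB j i by rewrite hwlog.
  by rewrite /coxB eq_sym orbC [(i.+1 == n) || _]orbC.
have := ltn_ord i; have := ltn_ord j => jn iltn.
rewrite /coxB; case: eqP => [-> //|/eqP nij].
rewrite -val_eqE /= in nij; case: ifP => [ij1|nij1].
  have ij1' : i.+1 = j by lia.
  case: ifP => [ijn|nijn]; first by apply: h4 => //; lia.
  by apply: h3 => //; lia.
by apply: alt_prod_comm; apply: h2; lia.
Qed.

Fact genBA_rel (i j : 'I_n) : alt_prod (genBA i) (genBA j) (coxB i j)
                     = alt_prod (genBA j) (genBA i) (coxB i j).
Proof.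
apply: coxB_rel_ind => {}i {}j; rewrite /genBA.
- move=> ij; have := ltn_ord j => jn; rewrite (_ : (i.+1 < n)%N); last by lia.
  have comm (k l : 'I_(n.*2.-1)) : (k.+1 < l)%N || (l.+1 < k)%N ->
      commute (artin_gen (coxA n.*2.-1) k) (artin_gen (coxA n.*2.-1) l).
    by move=> kl; apply/artin_comm/coxA_far.
  case: ifP => j1n; last first.
    by apply/commute_sym/commuteM; apply: comm; rewrite ?autA_val /=; lia.
  by apply: commuteM; apply/commute_sym/commuteM; apply: comm;
     rewrite ?autA_val /=; lia.
- move=> ij jn; rewrite (_ : (i.+1 < n)%N) ?jn; last by lia.
  by apply: alt_prod_braid3;
    [apply: artin_braid3; apply: coxA_next | apply: artin_braid3; apply: coxA_next
    |apply: artin_comm; apply: coxA_far..];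
    rewrite ?autA_val /=; lia.
- move=> ij jn; have -> : (i.+1 < n)%N by lia.
  have -> : (j.+1 < n)%N = false by lia.
  apply: alt_prod_braid4.
  + by apply: artin_comm; apply: coxA_far; rewrite ?autA_val /=; lia.
  + by apply: artin_braid3; apply: coxA_next; rewrite ?autA_val /=; lia.
  + by apply: artin_braid3; apply: coxA_next; rewrite ?autA_val /=; lia.
Qed.

Fact genBD_rel (i j : 'I_n) : alt_prod (genBD i) (genBD j) (coxB i j)
                     = alt_prod (genBD j) (genBD i) (coxB i j).
Proof.
apply: coxB_rel_ind => {}i {}j; rewrite /genBD.
- move=> ij; have := ltn_ord j => jn; rewrite (_ : (i.+1 < n)%N); last by lia.
  case: ifP => j1n; last apply: commuteM;
    by apply: artin_comm; apply: coxD_comm; rewrite -?val_eqE /adjD /=; lia.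
- move=> ij jn; rewrite (_ : (i.+1 < n)%N) ?jn; last by lia.
  rewrite /= !mulg1 !mulgA; apply: artin_braid3; apply: coxD_adj.
  by rewrite /adjD /=; lia.
- move=> ij jn; have -> : (i.+1 < n)%N by lia.
  have -> : (j.+1 < n)%N = false by lia.
  apply/esym; apply: alt_prod_braid4.
  + by apply: artin_comm; apply: coxD_comm; rewrite -?val_eqE /adjD /=; lia.
  + by apply: artin_braid3; apply: coxD_adj; rewrite /adjD /=; lia.
  + by apply: artin_braid3; apply: coxD_adj; rewrite /adjD /=; lia.
Qed.

Definition iotaA : artin coxB -> artin (coxA n.*2.-1) := artin_lift genBA.
Definition iotaD : artin coxB -> artin (coxD n) := artin_lift genBD.

Lemma iotaAM x y : iotaA (x * y)%g = (iotaA x * iotaA y)%g.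
Proof. exact/artin_liftM/genBA_rel. Qed.

Lemma iotaA_gen i : iotaA (artin_gen coxB i) = genBA i.
Proof. exact/artin_lift_gen/genBA_rel. Qed.

Lemma iotaDM x y : iotaD (x * y)%g = (iotaD x * iotaD y)%g.
Proof. exact/artin_liftM/genBD_rel. Qed.

Lemma iotaD_gen i : iotaD (artin_gen coxB i) = genBD i.
Proof. exact/artin_lift_gen/genBD_rel. Qed.

End TypeB.

(* The restrictions rho1, rho3 of psi1, psi3 to the fixed submodules are
   determined by twisted_rep. *)
Definition twisted_nonequiv (K : realType) (R : comUnitRingType) (b c d : R)
    (n : nat) : Prop :=
  forall (psi1 : linrep (artin (coxA n.*2.-1)) (lkmod K (coxA n.*2.-1) R))
         (psi3 : linrep (artin (coxD n)) (lkmod K (coxD n) R))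
         (rho1 : linrep (artin (@coxB n))
                   (fixmod K (coxA n.*2.-1) R <[autA n.*2.-1]>%G))
         (rho3 : linrep (artin (@coxB n)) (fixmod K (coxD n) R <[autD n]>%G)),
    LK_rep b c d psi1 -> LK_rep b c d psi3 ->
    twisted_rep (@iotaA n) psi1 rho1 -> twisted_rep (@iotaD n) psi3 rho3 ->
    ~ rep_equiv rho1 rho3.

(* Main.v *)
Require Import Defs.
From HB Require Import structures.
From mathcomp Require Import all_boot all_order all_algebra.
From mathcomp Require Import reals.
From mathcomp Require Import all_fingroup boolp trigo.
From mathcomp.multinomials Require Import freeg.
From mathcomp Require Import zify ring lra.

Set Implicit Arguments.
Unset Strict Implicit.
Unset Printing Implicit Defensive.

Import Order.TTheory GRing.Theory Num.Theory.
Local Open Scope ring_scope.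

(* Let T be the image of Delta_n.  In type A_(2n-1), T is the action of the middle
   generator s_n, and phi_n is annihilated by (X - d)(X + bc/d) modulo e_(alpha_n);
   hence P(T), for P = (X - d)(X + bc/d), maps the fixed submodule into the line
   spanned by e_(alpha_n).  In type D_(n+1), T is the action of s_n s_(n+1), which
   on each block of roots e_i -/+ e_n, e_i -/+ e_(n+1) (i < n) acts as the tensor
   square of the 2x2 matrix [[a, b], [c, 0]], whose eigenvalues are d and -bc/d.
   So mu^2 is an eigenvalue of T for mu = d and for mu = -bc/d, and there are n - 1 >= 2
   blocks.  As 2r <> p + q, one has P(mu^2) <> 0 for mu = d if r <> 0 and for
   mu = -bc/d if r = 0; then P(T) has rank at least 2, so that the two
   representations are non-equivalent for every n >= 3, with no exception. *)

(** * Roots and reflections *)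

(** Since 2 pi / 3 = pi - pi / 3, the duplication formula gives (2c - 1)(c + 1) = 0 for the cosine
    c, and c > 0 excludes -1. *)
Lemma cos_pi3 (K : realType) : cos (pi / 3 : K) = 2^-1.
Proof.
have pi_gt0 : 0 < pi :> K := pi_gt0 K.
have c_gt0 : 0 < cos (pi / 3 : K) by apply: cos_gt0_pihalf; apply/andP; split; lra.
have c3 : cos (pi / 3 *+ 2 : K) = - cos (pi / 3 : K).
  have -> : pi / 3 *+ 2 = - (pi / 3) + pi :> K by rewrite mulr2n; field.
  by rewrite cosDpi cosN.
have /eqP : (cos (pi / 3) *+ 2 - 1) * (cos (pi / 3) + 1) = 0 :> K.
  rewrite (_ : _ * _ = cos (pi / 3) ^+ 2 *+ 2 - 1 + cos (pi / 3)); last by ring.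
  by rewrite -cos_mulr2n c3 addNr.
rewrite mulf_eq0 => /orP[|]/eqP; lra.
Qed.

Section Forms.
Variables (K : realType) (I : finType) (m : small_coxeter I).
Implicit Types (u v w : {ffun I -> K}) (i j : I).
Local Notation form := (@root_form K I m).
Local Notation sroot := (simple_root K).

Definition height u : K := \sum_i u i.

(** This is how finite type enters: it bounds the pairings of roots, and thereby makes depth equal
    to height. *)
Definition posdef := forall u, u != 0 -> 0 < form u u.

Lemma root_form_simpleE i j : form (sroot i) (sroot j) =
  if i == j then 2 else if m i j == 3%N then -1 else 0.
Proof.
rewrite root_form_simple; have := cox_small m i j; rewrite !inE -(cox_diag m).
case/or3P => /eqP -> /=; first by rewrite divr1 cospi; ring.
  by rewrite cos_pihalf mulr0.
by rewrite cos_pi3; field.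
Qed.

Lemma root_formE u v : form u v = \sum_i \sum_j u i * v j * form (sroot i) (sroot j).
Proof. by do 2!apply: eq_bigr => ? _; rewrite root_form_simple. Qed.

Lemma root_formC u v : form u v = form v u.
Proof.
rewrite /root_form exchange_big; do 2!apply: eq_bigr => ? _.
by rewrite cox_sym [u _ * _]mulrC.
Qed.

Lemma root_form_linr u v w x :
  form w [ffun j => u j - x * v j] = form w u - x * form w v.
Proof. by rewrite !(root_formC w) root_form_linl. Qed.

Lemma root_form_simpler u j : form u (sroot j) = \sum_i u i * form (sroot i) (sroot j).
Proof.
rewrite root_formE; apply: eq_bigr => i _; rewrite (bigD1 j) //= big1 => [|k kj].
  by rewrite addr0 ffunE eqxx mulr1.
by rewrite ffunE eq_sym (negPf kj) mulr0 mul0r.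
Qed.

Lemma root_form_sum u v : form u v = \sum_i u i * form (sroot i) v.
Proof.
rewrite root_formE; apply: eq_bigr => i _.
rewrite [form (sroot i) v]root_formC root_form_simpler mulr_sumr.
by apply: eq_bigr => j _; rewrite mulrA [form (sroot j) _]root_formC.
Qed.

Lemma root_form_refl i u v : form (refl m i u) v =
  form u v - form u (sroot i) * form (sroot i) v.
Proof. exact: root_form_linl. Qed.

Lemma refl_isometry i u v : form (refl m i u) (refl m i v) = form u v.
Proof.
rewrite root_form_refl !root_form_linr root_form_simple2 [form v _]root_formC.
ring.
Qed.

Lemma height_refl i u : height (refl m i u) = height u - form u (sroot i).
Proof.
transitivity (\sum_j (u j - form u (sroot i) * sroot i j)).
  by apply: eq_bigr => j _; rewrite ffunE.
rewrite sumrB -mulr_sumr (_ : \sum_j sroot i j = 1) ?mulr1 // (bigD1 i) //= ffunE eqxx.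
by rewrite big1 ?addr0 // => j ji; rewrite ffunE eq_sym (negPf ji).
Qed.

Lemma root_refl i u : is_root m u -> is_root m (refl m i u).
Proof. by move=> [s [j ->]]; exists (i :: s), j. Qed.

Lemma root_word_act s u : is_root m u -> is_root m (word_act m s u).
Proof. by move=> ru; elim: s => //= i s; apply: root_refl. Qed.

Lemma simple_root_int i j : sroot i j \is a Num.int.
Proof. by rewrite ffunE rpred_nat. Qed.

Lemma root_form_int u i : (forall j, u j \is a Num.int) -> form u (sroot i) \is a Num.int.
Proof.
move=> uZ; rewrite root_form_simpler rpred_sum // => j _; rewrite rpredM //.
by rewrite root_form_simpleE; do 2?case: ifP => _; rewrite ?rpredN ?rpred_nat ?rpred1 ?rpred0.
Qed.

Lemma root_int u : is_root m u -> forall i, u i \is a Num.int.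
Proof.
move=> [s [j ->]]; elim: s => [|k s IHs] i /=; first exact: simple_root_int.
by rewrite ffunE rpredB // rpredM ?root_form_int ?simple_root_int.
Qed.

Lemma root_norm u : is_root m u -> form u u = 2.
Proof.
move=> [s [j ->]]; elim: s => [|k s IHs] /=; first exact: root_form_simple2.
by rewrite refl_isometry.
Qed.

(* The [a i] are the simple roots in coordinates where the form is the standard
   scalar product, and the [o i] form the dual basis. *)
Lemma posdef_of_realization (M : nat) (a o : I -> 'I_M -> K) :
    (forall i j, \sum_k a i k * a j k = form (sroot i) (sroot j)) ->
    (forall i j, \sum_k a i k * o j k = (i == j)%:R) ->
  posdef.
Proof.
move=> aa ao u u0; pose x k := \sum_i u i * a i k.
have uE : form u u = \sum_k x k ^+ 2.
  rewrite root_formE.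
  transitivity (\sum_i \sum_j \sum_k (u i * a i k) * (u j * a j k)).
    apply: eq_bigr => i _; apply: eq_bigr => j _; rewrite -aa mulr_sumr.
    by apply: eq_bigr => k _; rewrite mulrACA.
  under eq_bigr do rewrite exchange_big.
  rewrite exchange_big; apply: eq_bigr => k _; rewrite expr2 mulr_suml.
  by apply: eq_bigr => i _; rewrite mulr_sumr.
rewrite uE lt0r sumr_ge0 ?andbT => [|k _]; last exact: sqr_ge0.
apply: contra_neqN u0 => /eqP x0; apply/ffunP => j; rewrite ffunE.
have xk k : x k = 0.
  have /eqP := x0; rewrite psumr_eq0 => [/allP/(_ k)|k' _]; last exact: sqr_ge0.
  by rewrite mem_index_enum sqrf_eq0 => /(_ isT)/eqP.
(* Pairing [x] with the dual vector [o j] recovers the coordinate [u j]. *)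
transitivity (\sum_k x k * o j k); last by rewrite big1 // => k _; rewrite xk mul0r.
transitivity (\sum_i u i * (i == j)%:R).
  by rewrite (bigD1 j) //= eqxx mulr1 big1 ?addr0 // => i /negPf->; rewrite mulr0.
under eq_bigr do rewrite -ao mulr_sumr.
rewrite exchange_big; apply: eq_bigr => k _; rewrite mulr_suml.
by apply: eq_bigr => i _; rewrite mulrA.
Qed.

End Forms.

(** * Depth and height *)

Section Depth.
Variables (K : realType) (I : finType) (m : small_coxeter I).
Hypothesis m_posdef : posdef K m.
Implicit Types (u v : {ffun I -> K}) (i j : I) (r s : posroot K m).
Local Notation form := (@root_form K I m).
Local Notation sroot := (simple_root K).

Lemma posroot_root r : is_root m (val r).
Proof. by have /andP[/asboolP] := valP r. Qed.

Lemma posroot_ge0 r i : 0 <= val r i.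
Proof. by have /andP[_ /forallP] := valP r. Qed.

(** The nonzero vector u - alpha_i has norm 4 - 2(u|alpha_i) > 0, and the pairing is an integer. *)
Lemma root_form_le1 u i : is_root m u -> u != sroot i -> form u (sroot i) <= 1.
Proof.
move=> ru ui; have ri : is_root m (sroot i) by exists [::], i.
have w0 : [ffun j => u j - 1 * sroot i j] != 0.
  apply: contra_neq ui => /ffunP E; apply/ffunP => j.
  by move: (E j); rewrite !ffunE mul1r => /eqP; rewrite subr_eq0 => /eqP.
have := m_posdef w0; rewrite root_form_linl.
rewrite !root_form_linr !root_norm //.
rewrite [form (sroot i) u]root_formC.
have /intrP[z ->] := root_form_int m i (root_int ru).
move=> lt2; have {lt2} : z%:~R < 2%:~R :> K by lra.
by rewrite -[X in _ <= X]/1%:~R ltr_int ler_int; lia.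
Qed.

(** Reflecting by s_i changes the sign of the pairing, so the upper bound for s_i(u) applies. *)
Lemma root_form_geN1 u i : is_root m u -> u != - sroot i -> -1 <= form u (sroot i).
Proof.
move=> ru ui; have rru := root_refl i ru.
have : refl m i u != sroot i.
  by apply: contra_neq ui => E; rewrite -(refl_simple K m i) -E reflK.
move=> /(root_form_le1 rru); rewrite root_form_refl root_form_simple2; lra.
Qed.

(** The cases mirror the branches of [phi_basis], with the comparison of depths replaced by the
    value of the pairing with alpha_i. *)
Variant posroot_refl_spec i r : Prop :=
| PosrootSimple of r = simple_posroot K m i
| PosrootFixed of refl m i (val r) = val r & form (val r) (sroot i) = 0
| PosrootUp s of val s = refl m i (val r) & form (val r) (sroot i) = -1
| PosrootDown s of val s = refl m i (val r) & form (val r) (sroot i) = 1.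

Lemma posroot_reflP i r : posroot_refl_spec i r.
Proof.
have rr := posroot_root r; have rZ := root_int rr.
have [/eqP ri|ri] := boolP (val r == sroot i).
  by apply: PosrootSimple; apply: val_inj.
have le1 := root_form_le1 rr ri.
have geN1 : -1 <= form (val r) (sroot i).
  apply: root_form_geN1 => //; apply/eqP => /ffunP/(_ i).
  have := posroot_ge0 r i; rewrite !ffunE eqxx mulr1n => ? ?; lra.
have reflE j : refl m i (val r) j = val r j - form (val r) (sroot i) * (i == j)%:R.
  by rewrite !ffunE.
have mk : (forall j, 0 <= refl m i (val r) j) -> exists s : posroot K m, val s = refl m i (val r).
  move=> ge0; have pr : is_posroot m (refl m i (val r)).
    by apply/andP; split; [apply/asboolP; exact: root_refl|apply/forallP].
  by exists (PosRoot pr).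
have /intrP[z fz] := root_form_int m i rZ.
have : z \in [:: -1; 0; 1 : int].
  move: le1 geN1; rewrite fz -[1]/1%:~R -mulrNz !ler_int !inE; lia.
rewrite !inE => /or3P[] /eqP zE; rewrite zE in fz.
- case: mk => [j|s sE]; last exact: (PosrootUp sE).
  by rewrite reflE fz mulN1r opprK addr_ge0 // ?posroot_ge0.
- by apply: PosrootFixed => //; apply/ffunP => j; rewrite reflE fz mul0r subr0.
- case: mk => [j|s sE]; last exact: (PosrootDown sE).
  rewrite reflE fz mul1r; case: eqP => [<-|_]; last by rewrite subr0 posroot_ge0.
  (* Only the coordinate at i decreases. Were it smaller than 1, it would be 0, and every remaining
     term of the pairing would be at most 0, whereas the pairing is 1. *)
  rewrite subr_ge0 leNgt; apply/negP => ri1.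
  have ri0 : val r i = 0.
    have := posroot_ge0 r i; have /intrP[y yE] := rZ i; rewrite yE in ri1 *.
    rewrite ler0z => y0; move: ri1; rewrite -[1]/1%:~R ltr_int => y1.
    by rewrite (_ : y = 0) //; lia.
  have : form (val r) (sroot i) <= 0.
    rewrite root_form_simpler sumr_le0 // => k _.
    rewrite root_form_simpleE; have := posroot_ge0 r k.
    by case: eqP => [->|_]; [rewrite ri0 mul0r|case: ifP => _; rewrite ?mulr0 ?mulrN1 ?oppr_le0].
  rewrite fz; lra.
Qed.

Lemma height_simple i : height (sroot i) = 1.
Proof.
rewrite /height (bigD1 i) //= big1 ?addr0 => [|j ji]; first by rewrite ffunE eqxx.
by rewrite ffunE eq_sym (negPf ji).
Qed.

Lemma height_posroot_ge0 r : 0 <= height (val r).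
Proof. by rewrite sumr_ge0 // => i _; apply: posroot_ge0. Qed.

(** A letter lowers the height by at most one, except when it meets its own simple root. At that
    moment the height is 1, so the number of letters read already bounds [height u]: this is the
    left alternative, which then persists. *)
Lemma height_word_act u (s : seq I) : is_root m u ->
  height u <= (size s)%:R \/ height u <= (size s)%:R + height (word_act m s u).
Proof.
move=> ru; elim: s => [|i s [IHs|IHs]] /=; first by right; rewrite add0r.
  by left; apply: le_trans IHs _; rewrite ler_nat.
have [/eqP E|ne] := boolP (word_act m s u == sroot i).
  by left; apply: le_trans IHs _; rewrite E height_simple natr1.
right; have := root_form_le1 (root_word_act s ru) ne.
rewrite height_refl -natr1; lra.
Qed.

Lemma depthP r : (exists2 w, has_length m w (depth r) & is_negroot m (w (val r)))
  /\ forall w k, has_length m w k -> is_negroot m (w (val r)) -> (depth r <= k)%N.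
Proof.
rewrite /depth; case: ex_minnP => k /asboolP kr kmin; split=> // w l wl wr.
by apply: kmin; apply/asboolP; exists w.
Qed.

Lemma depth_word r (s : seq I) : is_negroot m (word_act m s (val r)) -> (depth r <= size s)%N.
Proof.
move=> neg; have [k ks] := has_length_ex K m s.
by apply: leq_trans; apply: (proj2 (depthP r)) ks neg.
Qed.

Lemma depth_reflS i r s : val s = refl m i (val r) -> (depth s <= (depth r).+1)%N.
Proof.
move=> sE; have [[w [[t -> <-] _] neg] _] := depthP r.
rewrite -[(size t).+1]addn1 -(size_cat t [:: i]).
by apply: depth_word; rewrite word_act_cat /= sE reflK.
Qed.

Lemma depth_simple i : (depth (simple_posroot K m i) <= 1)%N.
Proof.
apply: (@depth_word _ [:: i]).
by rewrite /= refl_simple /is_negroot opprK simple_posroot_subproof.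
Qed.

(** After a shortest word making [r] negative the height is at most 0, so both alternatives of
    [height_word_act] give the bound. *)
Lemma height_le_depth r : height (val r) <= (depth r)%:R.
Proof.
have [[w [[s -> <-] _] neg] _] := depthP r.
have [//|] := height_word_act s (posroot_root r).
have := height_posroot_ge0 (PosRoot neg); rewrite /height /=.
under eq_bigr do rewrite ffunE; rewrite sumrN; lra.
Qed.

(** In 2 = (r|r) = sum of r_i (alpha_i|r) the coefficients r_i are non-negative, so some pairing is
    positive. *)
Lemma posroot_descent r : exists i, 0 < form (val r) (sroot i).
Proof.
apply/existsP; rewrite -[X in is_true X]negbK negb_exists; apply/negP => /forallP np.
have := root_norm (posroot_root r); rewrite root_form_sum => E.
have : \sum_i val r i * form (sroot i) (val r) <= 0 :> K.
  apply: sumr_le0 => i _; rewrite root_formC mulr_ge0_le0 ?posroot_ge0 //.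
  by rewrite leNgt.
rewrite E; lra.
Qed.

(** The remaining inequality goes by induction on the height: a reflection with positive pairing
    lowers it by exactly one, unless the root is simple. Depths can then be compared through the
    sign of a pairing. *)
Lemma depthE r : (depth r)%:R = height (val r).
Proof.
apply/eqP; rewrite eq_le height_le_depth andbT.
have /natrP[k rk] : height (val r) \is a Num.nat.
  by rewrite natrEint height_posroot_ge0 rpred_sum // => i _; rewrite (root_int (posroot_root r)).
rewrite rk ler_nat; elim: k r rk => [|k IHk] r rk.
all: have [i ri] := posroot_descent r.
all: case: (posroot_reflP i r) => [rE|_|s sE|s sE]; try by [move=> E; move: ri; rewrite E; lra].
- by move: rk; rewrite rE height_simple; lra.
- by move=> ri1; have := height_posroot_ge0 s; rewrite sE height_refl ri1 rk; lra.
- by rewrite rE; apply: leq_trans (depth_simple i) _.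
- move=> ri1; apply: leq_trans (depth_reflS (i := i) (r := s) _) _; first by rewrite sE reflK.
  by rewrite ltnS IHk // sE height_refl ri1 rk -natr1 addrK.
Qed.

Lemma depth_up i r s : val s = refl m i (val r) -> form (val r) (sroot i) = -1 ->
  (depth r < depth s)%N.
Proof.
move=> sE ri; rewrite -(ltr_nat K) !depthE sE height_refl ri; lra.
Qed.

End Depth.

(** * Generators of an LK-representation *)

Section LKGenerators.
Variables (K : realType) (I : finType) (m : small_coxeter I).
Hypothesis m_posdef : posdef K m.
Variables (R : comUnitRingType) (b c d : R).
Hypothesis d_unit : d \is a GRing.unit.
Implicit Types (i : I) (r s : posroot K m) (u v : lkmod K m R).
Local Notation V := (lkmod K m R).
Local Notation e := (ebasis R).
Local Notation a := (lk_a b c d).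
Local Notation phi := (@phi K I m R b c d).
Local Notation alpha := (simple_posroot K m).

Lemma lkmod_ind (P : V -> Prop) : P 0 -> (forall r, P (e r)) ->
  (forall k u v, P u -> P v -> P (k *: u + v)) -> forall v, P v.
Proof.
move=> P0 Pe PD v; rewrite -[v]freeg_sumE; elim: (dom v) => [|r l IHl].
  by rewrite big_nil.
rewrite big_cons (_ : << coeff r v *g r >> = coeff r v *: e r :> {freeg _ / R}); last first.
  by apply/eqP/freeg_eqP => s; rewrite coeffZ !coeffU mul1r.
exact: PD.
Qed.

(** This says that [d] is a root of X^2 - aX - bc = (X - d)(X + bc/d). *)
Lemma lk_aE : a * d + b * c = d * d.
Proof. by rewrite /lk_a mulrBl divrK // subrK. Qed.

Lemma form_lt2_not_simple i r (x : K) : x < 2 -> root_form m (val r) (simple_root K i) = x ->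
  (r == alpha i) = false.
Proof.
move=> x2 ri; by apply/eqP => rE; move: x2; rewrite -ri rE root_form_simple2 ltxx.
Qed.

(** On a root fixed by s_i, [phi i] is the scalar [d], a root of the polynomial. On a pair exchanged
    by s_i, this is Cayley-Hamilton for [[a, b], [c, 0]]. On alpha_i, where [phi i] vanishes, only
    the constant term survives. *)
Lemma phi_quadratic i v :
  phi i (phi i v) - a *: phi i v - (b * c) *: v
  = - (b * c * coeff (alpha i) v) *: e (alpha i).
Proof.
elim/lkmod_ind: v => [|r|k u v IHu IHv].
- by rewrite !linear0 coeff0 mulr0 oppr0 scale0r !addr0.
- have eP (x : K) : x < 2 -> root_form m (val r) (simple_root K i) = x ->
      phi i (phi i (e r)) - a *: phi i (e r) - (b * c) *: e r = 0 ->
      phi i (phi i (e r)) - a *: phi i (e r) - (b * c) *: e r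
      = - (b * c * coeff (alpha i) (e r)) *: e (alpha i).
    by move=> x2 ri ->; rewrite coeffU (form_lt2_not_simple x2 ri) !mulr0 oppr0 scale0r.
  case: (posroot_reflP m_posdef i r) => [->|rfix ri|s sE ri|s sE ri].
  + by rewrite !phi_simple linear0 scaler0 !sub0r oppr0 sub0r coeffU eqxx !mulr1 scaleNr.
  + apply: (eP _ _ ri); first lra.
    rewrite !phi_fixed // linearZ /= phi_fixed // !scalerA -!scalerBl.
    by rewrite -addrA -opprD lk_aE subrr scale0r.
  + apply: (eP _ _ ri); first lra.
    have [phis phir] := phi_up b c d sE (depth_up m_posdef sE ri).
    rewrite phir linearP linearZ /= phis phir.
    by apply/eqP/freeg_eqP => z; rewrite !(coeffB, coeffD, coeffZ, coeff0); ring.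
  + apply: (eP _ _ ri); first lra.
    have rE : val r = refl m i (val s) by rewrite sE reflK.
    have si : root_form m (val s) (simple_root K i) = -1.
      by rewrite sE root_form_refl root_form_simple2 ri; ring.
    have [phir phis] := phi_up b c d rE (depth_up m_posdef rE si).
    rewrite phir linearZ /= phis.
    by apply/eqP/freeg_eqP => z; rewrite !(coeffB, coeffD, coeffZ, coeff0); ring.
- transitivity (k *: (phi i (phi i u) - a *: phi i u - (b * c) *: u)
                + (phi i (phi i v) - a *: phi i v - (b * c) *: v)).
    rewrite !(linearP (phi i)); apply/eqP/freeg_eqP => z.
    by rewrite !(coeffB, coeffD, coeffZ); ring.
  rewrite IHu IHv; apply/eqP/freeg_eqP => z.
  by rewrite !(coeffB, coeffD, coeffZ); ring.
Qed.

Variables (psi : linrep (artin m) V) (f : {scalar V}) (i : I).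
Hypothesis psiE : forall v, psi (artin_gen m i) v = phi i v + f v *: e (alpha i).

(** The correction by [f] stays in the line of e_(alpha_i), which [phi i] kills, so the quadratic
    relation persists modulo that line. *)
Lemma psi_quadratic v : exists x, psi (artin_gen m i) (psi (artin_gen m i) v)
  - a *: psi (artin_gen m i) v - (b * c) *: v = x *: e (alpha i).
Proof.
exists (f (psi (artin_gen m i) v) - a * f v - b * c * coeff (alpha i) v).
rewrite psiE; move: (f (psi _ v)) => y.
rewrite psiE linearD [phi i (_ *: _)]linearZ /= phi_simple scaler0 addr0.
have /eqP/freeg_eqP E := phi_quadratic i v; apply/eqP/freeg_eqP => z.
have := E z; rewrite !(coeffB, coeffD, coeffZ) => Ez.
by rewrite [RHS]mulrDl -Ez; ring.
Qed.

Definition weight (w : posroot K m -> R) : {linear V -> R^o} := free_ext (w : _ -> R^o).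

Lemma weight_basis w r : weight w (e r) = w r.
Proof. exact: free_extU. Qed.

(** A linear form vanishing at e_(alpha_i) does not see the unknown [f]. Being an eigenvector of the
    transpose thus only has to be checked for [phi i], on fixed roots and on exchanged pairs. *)
Lemma weight_eigen (w : posroot K m -> R) (mu : R) :
    w (alpha i) = 0 ->
    (forall r, root_form m (val r) (simple_root K i) = 0 -> d * w r = mu * w r) ->
    (forall r s, val s = refl m i (val r) ->
       root_form m (val r) (simple_root K i) = -1 ->
       a * w r + c * w s = mu * w r /\ b * w r = mu * w s) ->
  forall v, weight w (psi (artin_gen m i) v) = mu * weight w v.
Proof.
move=> w0 wfix wup v; rewrite psiE linearD.
rewrite (_ : weight w (f v *: _) = 0) ?addr0; last first.
  by rewrite linearZ weight_basis w0 [LHS]mulr0.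
elim/lkmod_ind: v => [|r|k u v IHu IHv].
- by rewrite !linear0 mulr0.
- case: (posroot_reflP m_posdef i r) => [->|rfix ri|s sE ri|s sE ri].
  + by rewrite phi_simple linear0 weight_basis w0 mulr0.
  + by rewrite phi_fixed // linearZ /= !weight_basis -wfix.
  + have [_ phir] := phi_up b c d sE (depth_up m_posdef sE ri).
    have [wE _] := wup _ _ sE ri.
    by rewrite phir linearP linearZ /= !weight_basis -wE.
  + have rE : val r = refl m i (val s) by rewrite sE reflK.
    have si : root_form m (val s) (simple_root K i) = -1.
      by rewrite sE root_form_refl root_form_simple2 ri; ring.
    have [phir _] := phi_up b c d rE (depth_up m_posdef rE si).
    have [_ wE] := wup _ _ rE si.
    by rewrite phir linearZ /= !weight_basis -wE.
- rewrite (linearP (phi i)) !(linearP (weight w)) IHu IHv.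
  by rewrite [RHS]mulrDr; congr (_ + _); apply: mulrCA.
Qed.

End LKGenerators.

(** * Types A and D *)

Lemma coxA_eq3 N (i j : 'I_N) :
  (coxA N i j == 3%N) = ((i.+1 == j) || (j.+1 == i)).
Proof.
have [ij|ij] := boolP ((i.+1 == j) || (j.+1 == i)); first by rewrite coxA_next.
by rewrite /= /coxA_fun (negPf ij); case: ifP.
Qed.

Lemma coxD_eq3 n (i j : 'I_n.+1) : (coxD n i j == 3%N) = adjD n i j || adjD n j i.
Proof.
have [ij|ij] := boolP (adjD n i j || adjD n j i); first by rewrite coxD_adj.
by rewrite /= /coxD_fun (negPf ij); case: ifP.
Qed.

Section PositiveDefinite.
Variable K : realType.

Let vec (s t : nat) (x : K) (k : nat) : K := (k == s)%:R + x * (k == t)%:R.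

Lemma vec_dot M s t x (F : nat -> K) : (s < M)%N -> (t < M)%N ->
  \sum_(k < M) vec s t x k * F k = F s + x * F t.
Proof.
have delta j : (j < M)%N -> \sum_(k < M) (k == j :> nat)%:R * F k = F j.
  move=> jM; rewrite (bigD1 (Ordinal jM)) //= eqxx mul1r big1 ?addr0 // => k.
  by rewrite -val_eqE /= => /negPf ->; rewrite mul0r.
move=> sM tM; under eq_bigr do rewrite mulrDl -mulrA.
by rewrite big_split -mulr_sumr !delta.
Qed.

(** The usual realization alpha_i = eps_i - eps_(i+1), with dual vectors eps_0 + ... + eps_j. *)
Lemma coxA_posdef N : posdef K (coxA N).
Proof.
apply: (@posdef_of_realization K _ (coxA N) N.+1
  (fun (i : 'I_N) k => vec i i.+1 (-1) k) (fun (j : 'I_N) k => (k <= j)%N%:R)) => i j.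
  have [iN jN] := (ltn_ord i, ltn_ord j).
  rewrite vec_dot; [|lia..]; rewrite root_form_simpleE coxA_eq3 /vec -val_eqE /=.
  by do !case: eqP => ? /=; try lia; ring.
have [iN jN] := (ltn_ord i, ltn_ord j).
rewrite (vec_dot _ (fun k => (k <= j)%N%:R)); [|lia..].
rewrite -val_eqE /=; case: (ltngtP i j) => ? /=; ring.
Qed.

(** The usual realization: eps_i - eps_(i+1) for i < n, and eps_(n-1) + eps_n for the last vertex.
    The dual vectors are the fundamental weights, with coordinates 1/2 up to sign at the two
    leaves. *)
Lemma coxD_posdef n : (1 < n)%N -> posdef K (coxD n).
Proof.
move=> n1; pose a (i k : nat) := if (i < n)%N then vec i i.+1 (-1) k else vec n.-1 n 1 k.
pose o (j k : nat) : K := if (j.+1 < n)%N then (k <= j)%N%:R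
  else if (k == n) && (j != n) then - 2^-1 else 2^-1.
have a_dot (i : 'I_n.+1) (F : nat -> K) : \sum_(k < n.+1) a i k * F k =
    if (i < n)%N then F i - F i.+1 else F n.-1 + F n.
  have iN := ltn_ord i; rewrite /a; case: ifP => ilt.
    by rewrite vec_dot ?mulN1r //; lia.
  by rewrite vec_dot ?mul1r //; lia.
apply: (@posdef_of_realization K _ (coxD n) n.+1
  (fun (i : 'I_n.+1) k => a i k) (fun (j : 'I_n.+1) k => o j k)) => i j;
  have [iN jN] := (ltn_ord i, ltn_ord j); rewrite a_dot.
  rewrite root_form_simpleE coxD_eq3 /adjD /a /vec -val_eqE /=.
  by do !case: ifP => ? /=; do !case: eqP => ? /=; try lia; ring.
rewrite /o -val_eqE /=.
by do !case: ifP => ? /=; do !case: eqP => ? /=; do ?case: leqP => ? /=; try lia; field.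
Qed.

End PositiveDefinite.

(** * Rank of the image of (X - d)(X + bc/d) *)

Section Comparison.
Variables (K : realType) (R : comUnitRingType) (b c d x y mu : R).
Local Notation a := (lk_a b c d).

Lemma ebasis_fix (I : finType) (m : small_coxeter I) (g : {perm I}) (r : posroot K m) :
  perm_vec g (val r) = val r -> ebasis R r \in fix_pred <[g]>%G.
Proof.
move=> /ffunP gr; apply/forall_inP => _ /cycleP[k ->]; rewrite mod_actE /root_act.
suff -> : perm_vec (g ^+ k)%g (val r) = val r by rewrite valKd.
apply/ffunP => i; rewrite ffunE; elim: k i => [|k IHk] i.
  by rewrite expg0 invg1 perm1.
by rewrite expgS invMg permM -[RHS]IHk -[RHS]gr ffunE.
Qed.

Lemma linear_subZ (U V : lmodType R) (f : {linear U -> V}) (k l : R) (z1 z2 z3 : U) :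
  f (z1 - k *: z2 - l *: z3) = f z1 - k *: f z2 - l *: f z3.
Proof. by rewrite !linearB; congr (_ - _ - _); apply: linearZ. Qed.

(* (x, y) is a left eigenvector of the matrix [[a, b], [c, 0]] of phi_i on the span
   of e_alpha and e_(s_i alpha), alpha being the root of smaller depth. *)
Hypotheses (xE : a * x + c * y = mu * x) (yE : b * x = mu * y).

(* u and v are the two leaves attached to the branching vertex q, and p is the last
   vertex of the chain before q.  Having coordinates 1 at q and k at p selects the block
   of alpha_q for k = 0, and the union of all the other blocks for k = 1; both sets
   are stable under s_u and s_v, and on them the coordinates at u and v are 0 or 1. *)
Section DWeight.
Variables (n : nat) (p q u v : 'I_n.+1).
Hypotheses (n3 : (2 < n)%N) (pE : p.+3 = n) (qE : q.+2 = n) (uE : u.+1 = n) (vE : v = n :> nat).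
Local Notation D := (coxD n).

Definition Dcoef (z : K) : R := if z == 0 then x else y.

(** Tensor square of the left eigenvector (x, y), with one factor for each of the leaves [u] and
    [v], extended by zero. *)
Definition Dweight (k : K) (r : posroot K D) : R :=
  if (val r q == 1) && (val r p == k) then Dcoef (val r u) * Dcoef (val r v) else 0.

(** A vertex beyond [q] is one of the two leaves, whose only neighbour is [q]. *)
Lemma coxD_root_form (i : 'I_n.+1) (w : {ffun 'I_n.+1 -> K}) : (q < i)%N ->
  root_form D w (simple_root K i) = 2 * w i - w q.
Proof.
move=> qi; have iN := ltn_ord i.
have [iq qi'] : (i == q) = false /\ (q == i) = false.
  by split; rewrite -val_eqE /=; lia.
rewrite root_form_simpler (bigD1 i) //= (bigD1 q) /= ?qi' //.
rewrite !root_form_simpleE eqxx qi' coxD_eq3 big1 => [|j /andP[ji jq]].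
  rewrite (_ : adjD n q i || adjD n i q) ?addr0 ?mulrN1 ?[w i * 2]mulrC //.
  by rewrite /adjD; lia.
rewrite root_form_simpleE (negPf ji) coxD_eq3 (_ : _ || _ = false) ?mulr0 //.
by move: ji jq; rewrite -!val_eqE /adjD /=; lia.
Qed.

Lemma Dweight_eigen (psi : linrep (artin D) (lkmod K D R)) (f : {scalar lkmod K D R})
    (k : K) (i : 'I_n.+1) : (q < i)%N ->
    (forall z, psi (artin_gen D i) z
       = phi K D b c d i z + f z *: ebasis R (simple_posroot K D i)) ->
  forall z, weight (Dweight k) (psi (artin_gen D i) z) = mu * weight (Dweight k) z.
Proof.
move=> qi psiE; have iN := ltn_ord i.
have iq : (i == q) = false by rewrite -val_eqE /=; lia.
have ip : (i == p) = false by rewrite -val_eqE /=; lia.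
have iuv : i = u \/ i = v.
  by have [|] : i.+1 = n \/ i = n :> nat; [lia|left|right]; apply: val_inj => /=; lia.
have uv : (u == v) = false by rewrite -val_eqE /=; lia.
have nD : (1 < n)%N by lia.
apply: (weight_eigen (coxD_posdef nD) psiE).
- by rewrite /Dweight /= ffunE iq eq_sym oner_eq0.
(* Where the weight is nonzero, the pairing is 2 r_i - 1, which is odd; so no such root is fixed. *)
- move=> r; rewrite coxD_root_form // /Dweight; case: eqP => [-> ri|_ _]; last by rewrite !mulr0.
  have /intrP[z zE] := root_int (posroot_root r) i.
  have : 2 * z = 1.
    apply/eqP; rewrite -(eqr_int K) intrM -zE; apply/eqP; lra.
  lia.
- move=> r s sE ri; have sj j : val s j = val r j + (i == j)%:R.
    by rewrite sE ffunE ri mulN1r opprK ffunE.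
  rewrite /Dweight !sj iq ip !addr0; case: andP => [[/eqP rq _]|_]; last first.
    by rewrite !mulr0 addr0.
  have ri0 : val r i = 0 by move: ri; rewrite coxD_root_form // rq; lra.
  have c0 : Dcoef (val r i) = x by rewrite /Dcoef ri0 eqxx.
  have c1 : Dcoef (val r i + 1) = y by rewrite /Dcoef ri0 add0r oner_eq0.
  (* The coordinate at the other leaf does not move; its factor comes out and leaves [xE] and
     [yE]. *)
  case: iuv => iE; subst i; rewrite eqxx ?uv ?[v == u]eq_sym ?uv addr0 c0 c1.
    by rewrite !mulrA -mulrDl xE yE.
  by rewrite !mulrA -!(mulrC (Dcoef (val r u))) -!mulrA -mulrDr xE yE; split; ring.
Qed.

Lemma Droot_fix (r : posroot K D) : val r u = 0 -> val r v = 0 ->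
  ebasis R r \in fix_pred <[autD n]>%G.
Proof.
move=> ru rv; apply: ebasis_fix; apply/ffunP => i; rewrite ffunE /autD tpermV.
have uI : inord n.-1 = u by apply: val_inj; rewrite /= inordK; lia.
have vI : ord_max = v by apply: val_inj.
by rewrite uI vI; case: tpermP => [->|->|_ _]; rewrite ?ru ?rv.
Qed.

(** The witnesses are alpha_q for [false] and s_p(alpha_q) = alpha_p + alpha_q for [true]. *)
Lemma Droot_exists (k : bool) : exists r : posroot K D,
  [/\ val r q = 1, val r p = k%:R, val r u = 0 & val r v = 0].
Proof.
have ne (i j : 'I_n.+1) : (i != j :> nat) -> (i == j) = false by move/negPf.
have [pq pu pv] : [/\ (p == q) = false, (p == u) = false & (p == v) = false].
  by split; apply: ne; lia.
have [qp qu qv] : [/\ (q == p) = false, (q == u) = false & (q == v) = false].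
  by split; apply: ne; lia.
case: k; last first.
  by exists (simple_posroot K D q); rewrite /= !ffunE eqxx qp qu qv.
have := root_form_simpleE K D q p; rewrite qp coxD_eq3.
rewrite (_ : _ || _); last by rewrite /adjD; lia.
case: (posroot_reflP (coxD_posdef _) p (simple_posroot K D q)); first lia.
- move=> /(congr1 val)/ffunP/(_ q); rewrite !ffunE eqxx pq => /eqP.
  by rewrite oner_eq0.
- by move=> _ /= ->; lra.
- move=> s sE fE _; exists s; rewrite !sE /= !ffunE fE /=.
  rewrite !eqxx pq pu pv qp qu qv.
  by split; rewrite !mulN1r !opprK ?addr0 ?add0r.
- by move=> s _ /= ->; lra.
Qed.

End DWeight.

Hypothesis d_unit : d \is a GRing.unit.
Hypothesis R_integral : forall z t : R, z * t = 0 -> z = 0 \/ t = 0.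
Hypothesis x_neq0 : x <> 0.
Hypothesis mu_neq : (mu ^+ 2 - d) * (mu ^+ 2 + b * c / d) <> 0.

Theorem twisted_nonequiv_of_eigenvalue n : (2 < n)%N -> twisted_nonequiv K b c d n.
Proof.
move=> n3 psi1 psi3 rho1 rho3 [f1 [_ _ psi1E]] [f3 [_ _ psi3E]] tw1 tw3 [nu [[nu' nuK nu'K] nuE]].
have n1 : (n.-1 < n)%N by lia.
(* Counting from 0, [n.-1] is the index of Delta_n and also the middle vertex of A_(2n-1), fixed by
   [autA]. *)
pose i := Ordinal n1; pose Del := artin_gen (@coxB n) i.
pose j := widen_ord (widenA_subproof n) i.
have iotaAE : iotaA Del = artin_gen _ j.
  by rewrite iotaA_gen /genBA /= (_ : _ < _ = false)%N //; lia.
have jA : perm_vec (autA n.*2.-1) (val (simple_posroot K (coxA n.*2.-1) j))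
    = val (simple_posroot K (coxA n.*2.-1) j).
  rewrite /= perm_vec_simple; congr simple_root.
  by apply: val_inj; rewrite /= autA_val /=; lia.
have jfix := ebasis_fix jA.
pose Q1 v := rho1 Del (rho1 Del v) - a *: rho1 Del v - (b * c) *: v.
have Q1E v : exists z, Q1 v = z *: FixMod jfix.
  have [z zE] := psi_quadratic (@coxA_posdef K _) d_unit (psi1E j) (val v).
  exists z; apply: val_inj; by rewrite linearZ /Q1 linear_subZ /= !tw1 iotaAE.
have [up vp pp qp] : [/\ (n.-1 < n.+1)%N, (n < n.+1)%N, (n.-2.-1 < n.+1)%N & (n.-2 < n.+1)%N].
  by split; lia.
pose p := Ordinal pp; pose q := Ordinal qp; pose u := Ordinal up; pose v := Ordinal vp.
have [pE qE uE vE] : [/\ p.+3 = n, q.+2 = n, u.+1 = n & v = n :> nat] by split=> /=; lia.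
pose W k := weight (Dweight p q u v k).
have iotaDE : Defs.iotaD Del = (artin_gen (coxD n) u * artin_gen (coxD n) v)%g.
  rewrite iotaD_gen /genBD (_ : _ < _ = false)%N; last by rewrite /=; lia.
  by congr (artin_gen _ _ * artin_gen _ _)%g; apply: val_inj.
have W_eigen k z : W k (val (rho3 Del z)) = mu * mu * W k (val z).
  rewrite tw3 iotaDE linrepM -mulrA.
  by rewrite !(Dweight_eigen n3 pE qE uE vE _ _ (psi3E _)) //=; lia.
pose w := nu (FixMod jfix).
(* Transport by [nu] puts P(T) z on the line of [w]. The forms [W k] have eigenvalue mu^2 under T,
   so they turn P(T) into the scalar P(mu^2). *)
have rank1 (z : fixmod K (coxD n) R <[autD n]>%G) : exists t, forall k,
    (mu ^+ 2 - d) * (mu ^+ 2 + b * c / d) * W k (val z) = t * W k (val w).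
  have [t tE] := Q1E (nu' z); exists t => k.
  have tE3 : rho3 Del (rho3 Del z) - a *: rho3 Del z - (b * c) *: z = t *: w.
    by rewrite -[RHS]linearZ -tE /Q1 linear_subZ -!nuE nu'K.
  have <- : W k (val (rho3 Del (rho3 Del z))) - a * W k (val (rho3 Del z))
      - b * c * W k (val z) = t * W k (val w).
    pose F : {linear fixmod K (coxD n) R <[autD n]>%G -> R^o} := W k \o val.
    have FZ : F (t *: w) = t *: F w by apply: linearZ.
    by have := congr1 F tE3; rewrite FZ linear_subZ.
  rewrite !W_eigen /lk_a -[X in _ - X * W k _](divrK d_unit (b * c)).
  by move: (b * c / d) (W k (val z)) => e X; ring.
have [r0 [r0q r0p r0u r0v]] := Droot_exists n3 pE qE uE vE false.
have [r1 [r1q r1p r1u r1v]] := Droot_exists n3 pE qE uE vE true.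
have [t0 t0E] := rank1 (FixMod (Droot_fix n3 pE qE uE vE r0u r0v)).
have [t1 t1E] := rank1 (FixMod (Droot_fix n3 pE qE uE vE r1u r1v)).
have W0 k : W k (ebasis R r0) = if k == 0 then x * x else 0.
  by rewrite weight_basis /Dweight r0q r0p r0u r0v eqxx /Dcoef eqxx eq_sym.
have W1 k : W k (ebasis R r1) = if k == 1 then x * x else 0.
  by rewrite weight_basis /Dweight r1q r1p r1u r1v eqxx /Dcoef eqxx eq_sym.
have xx0 : (mu ^+ 2 - d) * (mu ^+ 2 + b * c / d) * (x * x) <> 0.
  by move=> /R_integral[//|/R_integral[]].
(* The matrix of [W 0], [W 1] on the vectors of [r0], [r1] is x^2 times the identity. Since [W 1]
   vanishes on [r0], either t0 = 0, contradicting [W 0] on [r0], or [W 1] kills [w], contradicting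
   [W 1] on [r1]. *)
have := t0E 1; rewrite /= W0 oner_eq0 mulr0 => /esym/R_integral[t00|w1].
  by have := t0E 0; rewrite /= W0 eqxx t00 mul0r.
by have := t1E 1; rewrite /= W1 eqxx w1 mulr0.
Qed.

End Comparison.

(** * Laurent monomials *)

Local Notation Y := laurent_y.

Lemma laurent_integral (z t : laurent) : z * t = 0 -> z = 0 \/ t = 0.
Proof.
move=> /(congr1 val); rewrite rmorphM rmorph0 => /eqP; rewrite mulf_eq0 !sub_val_eq0.
by case/orP => /eqP; [left|right].
Qed.

Lemma laurent_yzD i j : Y ^ (i + j) = Y ^ i * Y ^ j.
Proof. exact/exprzDr/laurent_y_unit. Qed.

Lemma laurent_yz_unit i : Y ^ i \is a GRing.unit.
Proof. exact/unitrXz/laurent_y_unit. Qed.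

Lemma laurent_yz_neq0 i : Y ^ i <> 0.
Proof. by move=> E; have := laurent_yz_unit i; rewrite E unitr0. Qed.

Lemma laurent_yn_tofrac n : val (Y ^ n%:Z) = tofrac ('X^n : {poly {poly int}}).
Proof. by rewrite -exprnP rmorphXn tofracXn. Qed.

Lemma laurent_yn_inj n : Y ^ n%:Z = 1 -> n = 0%N.
Proof.
move=> /(congr1 val); rewrite laurent_yn_tofrac rmorph1 -tofrac1 => /eqP.
rewrite tofrac_eq => /eqP/(congr1 (fun P : {poly _} => size P)).
by rewrite size_polyXn size_poly1; lia.
Qed.

(** Evaluating at y = 1, then at x = 0, would give 1 = -1 in the integers. *)
Lemma laurent_yn_neqN1 n : Y ^ n%:Z <> -1.
Proof.
move=> /(congr1 val); rewrite laurent_yn_tofrac rmorphN rmorph1 -tofrac1 -tofracN => /eqP.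
rewrite tofrac_eq => /eqP/(congr1 (horner^~ 1)); rewrite hornerXn expr1n hornerN hornerC.
by move=> /(congr1 (horner^~ 0)); rewrite hornerN !hornerC.
Qed.

Lemma laurent_yz_inj i j : Y ^ i = Y ^ j -> i = j.
Proof.
wlog ij : i j / i <= j => [W|] E.
  by have /orP[|] := le_total i j => h; [|symmetry]; apply: W.
have [n nE] : exists n : nat, j = i + n by exists `|j - i|%N; lia.
have : Y ^ i * (Y ^ n%:Z - 1) = 0 by rewrite mulrBr mulr1 -laurent_yzD -nE E subrr.
case/laurent_integral => [/laurent_yz_neq0 //|/eqP]; rewrite subr_eq0 => /eqP/laurent_yn_inj.
lia.
Qed.

Lemma laurent_yz_add_neq0 i j : Y ^ i + Y ^ j <> 0.
Proof.
wlog ij : i j / i <= j => [W|] E.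
  by have /orP[|] := le_total i j => h; [|rewrite addrC in E]; apply: W E.
have [n nE] : exists n : nat, j = i + n by exists `|j - i|%N; lia.
have : Y ^ i * (Y ^ n%:Z + 1) = 0 by rewrite mulrDr mulr1 -laurent_yzD -nE addrC.
case/laurent_integral => [/laurent_yz_neq0 //|/eqP]; rewrite addr_eq0 => /eqP.
exact: laurent_yn_neqN1.
Qed.

Theorem twisted_nonequiv_laurent (K : realType) (p q r : int) (n : nat) :
  2 * r <> p + q -> (2 < n)%N -> twisted_nonequiv K (Y ^ p) (Y ^ q) (Y ^ r) n.
Proof.
move=> hpqr n3; have dU := laurent_yz_unit r.
have eE : Y ^ p * Y ^ q / Y ^ r = Y ^ (p + q - r).
  by rewrite !laurent_yzD -invr_expz.
have neq (z t : laurent) : z <> 0 -> t <> 0 -> z * t <> 0.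
  by move=> z0 t0 /laurent_integral[].
have aE := lk_aE (Y ^ p) (Y ^ q) dU.
have sub0 i j : i <> j -> Y ^ i - Y ^ j <> 0.
  by move=> ij /eqP; rewrite subr_eq0 => /eqP/laurent_yz_inj.
have [r0|/eqP r0] := eqVneq r 0; last first.
  (* Here mu = d with left eigenvector (d, b); the factor d^2 - d is nonzero because r <> 0. *)
  apply: (@twisted_nonequiv_of_eigenvalue _ _ _ _ _ (Y ^ r) (Y ^ p) (Y ^ r)) => //.
  - by rewrite -aE [_ * Y ^ p]mulrC.
  - exact: mulrC.
  - exact: laurent_integral.
  - exact: laurent_yz_neq0.
  - rewrite eE expr2 -laurent_yzD; apply: neq; last exact: laurent_yz_add_neq0.
    by apply: sub0; lia.
(* Here mu = -bc/d with left eigenvector (-c, d). As r = 0, the factor mu^2 - d is y^(2(p+q)) - 1,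
   nonzero because p + q <> 2r = 0. *)
apply: (@twisted_nonequiv_of_eigenvalue _ _ _ _ _ (- Y ^ q) (Y ^ r) (- Y ^ (p + q - r))) => //.
- by rewrite /lk_a eE; ring.
- by rewrite mulrN mulNr -laurent_yzD -laurent_yzD; congr (- Y ^ _); lia.
- exact: laurent_integral.
- by move=> /eqP; rewrite oppr_eq0 => /eqP/laurent_yz_neq0.
- rewrite eE sqrrN expr2 -laurent_yzD; apply: neq; last exact: laurent_yz_add_neq0.
  by apply: sub0; lia.
Qed.

Theorem proposition56 (K : realType) (p q r : int) (hpqr : 2 * r <> p + q) :
  (~ ((r < 0 /\ 0 < p + q) \/ (p + q < 0 /\ 0 < r)) ->
     forall n : nat, (3 <= n)%N ->
       twisted_nonequiv K (laurent_y ^ p) (laurent_y ^ q) (laurent_y ^ r) n)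
  /\
  ((r < 0 /\ 0 < p + q) \/ (p + q < 0 /\ 0 < r) ->
     exists s : seq nat, (size s <= 2)%N /\
       forall n : nat, (3 <= n)%N -> n \notin s ->
         twisted_nonequiv K (laurent_y ^ p) (laurent_y ^ q) (laurent_y ^ r) n).
Proof.
split=> [_ n n3|_]; first exact: twisted_nonequiv_laurent.
by exists [::]; split=> // n n3 _; apply: twisted_nonequiv_laurent.
Qed.
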